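(* Let $t\ge 0$, and assume that the sequence of distributions $\lambda^{(N)}_t=\frac1N\sum_{i=1}^N\delta_{\rho^{(N)}_i((0,t])}$, $N\in\mathbb{N}$, on $\mathbb{R}_+$ converges weakly as $N\to\infty$ to a probability distribution $\lambda_t$. Then the scaled position of the boundary $$Y^{(N)}_C(t)=\frac1N\sum_{i=1}^N\mathbf{1}_{\{\tau^{(N)}_{i,1}\le t\}}$$ converges almost surely as $N\to\infty$ to $$y_C(t)=1-\int_0^\infty e^{-s}\,\lambda_t(ds).$$
   Context: $\mathbb{R}_+=[0,\infty)$, and $\delta_c$ denotes the unit point mass at $c$. For each positive integer $N$, $\nu^{(N)}_1,\dots,\nu^{(N)}_N$ are independent Poisson random measures on $\mathbb{R}_+$, defined on a probability space $(\Omega,\mathcal F,\mathrm P)$, with intensity measures $\rho^{(N)}_i$, i.e. $\mathrm E[\nu^{(N)}_i(A)]=\rho^{(N)}_i(A)$ for Borel $A\subset\mathbb{R}_+$. Each $\rho^{(N)}_i$ is a Radon measure on $\mathbb{R}_+$ and is continuous: $\rho^{(N)}_i(\{t\})=0$ for all $t\ge0$. As part of the setting, with probability $1$, $\nu^{(N)}_i=\sum_{j=1}^\infty\delta_{\tau^{(N)}_{i,j}}$ with $0<\tau^{(N)}_{i,1}<\tau^{(N)}_{i,2}<\cdots$, and $\tau^{(N)}_{i,j}\ne\tau^{(N)}_{i',j'}$ if $(i,j)\neq(i',j')$. *)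

(* Defs.v *)
From HB Require Import structures.
From mathcomp Require Import all_boot all_order all_algebra.
From mathcomp Require Import all_classical all_reals all_analysis measurable_realfun.

Set Implicit Arguments.
Unset Strict Implicit.
Unset Printing Implicit Defensive.

Import Order.TTheory GRing.Theory Num.Theory.
Import numFieldNormedType.Exports.

Local Open Scope classical_set_scope.
Local Open Scope ring_scope.

(* A measure on the half-line [0, +oo[ is a Borel measure on R that does not
   charge ]-oo, 0[. *)
Section measures_on_half_line.
Context {R : realType}.
Implicit Types mu : {measure set (measurableTypeR R) -> \bar R}.

Definition on_half_line mu : Prop := mu `]-oo, 0%R[%classic = 0%E.

Definition radon mu : Prop :=
  (forall K : set R, compact K -> (mu K < +oo)%E) /\
  (forall A : set (measurableTypeR R), measurable A ->
     mu A = ereal_sup [set mu K | K in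
                        [set K : set R | compact K /\ K `<=` A]]).

Definition continuous_measure mu : Prop :=
  forall t : R, 0 <= t -> mu [set t] = 0%E.

Definition weak_cvg_half_line
    (mu_ : nat -> {measure set (measurableTypeR R) -> \bar R}) mu : Prop :=
  forall f : R -> R,
    {within `[0%R, +oo[%classic, continuous f} ->
    (exists M : R, forall x : R, 0 <= x -> `|f x| <= M) ->
    (\int[mu_ n]_(x in `[0%R, +oo[%classic) f x) @[n --> \oo] -->
      \int[mu]_(x in `[0%R, +oo[%classic) f x.

End measures_on_half_line.

Section empirical_measure.
Context {R : realType}.
Local Open Scope ereal_scope.
Variables (N : nat) (x : 'I_N -> measurableTypeR R).

(* The zero measure when N = 0. *)
Definition empirical (A : set (measurableTypeR R)) : \bar R :=
  (N%:R^-1)%:E * \sum_(i < N) \d_(x i) A.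

Let empirical0 : empirical set0 = 0.
Proof. by rewrite /empirical big1 ?mule0. Qed.

Let empirical_ge0 A : 0 <= empirical A.
Proof. by apply: mule_ge0; [rewrite lee_fin|apply: sume_ge0]. Qed.

Let empirical_sigma_additive : semi_sigma_additive empirical.
Proof.
move=> F mF tF mUF; rewrite [X in _ --> X](_ : _ =
    lim ((fun n => \sum_(0 <= k < n) empirical (F k)) @ \oo)).
  by apply: is_cvg_ereal_nneg_natsum => k _.
rewrite nneseriesZl//; last by move=> k _; exact: sume_ge0.
rewrite /empirical nneseries_sum//; congr (_ * _); apply: eq_bigr => /= i _.
exact: measure_semi_bigcup.
Qed.

HB.instance Definition _ := isMeasure.Build _ _ _ empirical
  empirical0 empirical_ge0 empirical_sigma_additive.

End empirical_measure.

Section independence.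
Context {d : measure_display} {T : measurableType d} {R : realType}.
Variable P : probability T R.

Definition independent_systems (I : finType) (F : I -> set_system T) : Prop :=
  forall (J : {set I}) (E : I -> set T),
    (forall i, i \in J -> F i (E i)) ->
    P (\bigcap_(i in [set` J]) E i) = (\prod_(i in J) P (E i))%E.

End independence.

Section poisson_random_measures.
Context {d : measure_display} {T : measurableType d} {R : realType}.
Variable P : probability T R.
Implicit Types (nu : R.-ker T ~> measurableTypeR R)
  (rho : {measure set (measurableTypeR R) -> \bar R}).

Definition evaluation_sigma nu (A : set (measurableTypeR R)) : set_system T :=
  preimage_set_system [set: T] (fun w => nu w A) measurable.

Definition random_measure_sigma nu : set_system T :=
  <<s \bigcup_(A in measurable) evaluation_sigma nu A >>.

(* nu A is Poisson distributed with parameter rho A, where the Poisson law of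
   infinite parameter is the unit mass at +oo.  The nat argument of
   poisson_prob is a dummy, and poisson_prob 0 is the unit mass at 0. *)
Definition poisson_random_measure nu rho : Prop :=
  [/\ forall (A : set (measurableTypeR R)) (r : R), measurable A ->
        rho A = r%:E -> forall k : nat,
        P [set w | nu w A = (k%:R)%:E] = poisson_prob r 0%N [set k],
      forall A : set (measurableTypeR R), measurable A ->
        rho A = +oo%E -> P [set w | nu w A = +oo%E] = 1%E
    & forall (n : nat) (A : 'I_n -> set (measurableTypeR R)),
        (forall k, measurable (A k)) -> trivIset setT A ->
        independent_systems P (fun k => evaluation_sigma nu (A k))].

Definition independent_random_measures (I : finType)
    (nu : I -> R.-ker T ~> measurableTypeR R) : Prop :=
  independent_systems P (fun i => random_measure_sigma (nu i)).

(* tau i j w is the (j+1)-th point of nu i w. *)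
Definition simple_point_representation (N : nat)
    (nu : 'I_N -> R.-ker T ~> measurableTypeR R)
    (tau : 'I_N -> nat -> T -> R) : Prop :=
  {ae P, forall w,
    [/\ forall i (A : set (measurableTypeR R)), measurable A ->
          nu i w A =
            (\sum_(0 <= j <oo) \d_(tau i j w : measurableTypeR R) A)%E,
        forall i, 0 < tau i 0%N w,
        forall i j, tau i j w < tau i j.+1 w
      & forall i j i' j', (i, j) <> (i', j') -> tau i j w <> tau i' j' w]}.

End poisson_random_measures.

Section boundary.
Context {R : realType}.

Definition lambdaN
    (rho : forall N, 'I_N -> {measure set (measurableTypeR R) -> \bar R})
    (t : R) (N : nat) : {measure set (measurableTypeR R) -> \bar R} :=
  empirical (fun i : 'I_N => fine (rho N i `]0%R, t]%classic) : measurableTypeR R).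

Definition Y_C {T : Type} (tau : forall N, 'I_N -> nat -> T -> R)
    (t : R) (N : nat) (w : T) : R :=
  N%:R^-1 * \sum_(i < N) (tau N i 0%N w <= t)%R%:R.

Definition y_C (lambda_t : {measure set (measurableTypeR R) -> \bar R}) : R :=
  1 - \int[lambda_t]_(s in `[0%R, +oo[%classic) expR (- s).

End boundary.

(* Main.v *)
Require Import Defs.
From HB Require Import structures.
From mathcomp Require Import all_boot all_order all_algebra.
From mathcomp Require Import all_classical all_reals all_analysis measurable_realfun.
From mathcomp Require Import lra.

Set Implicit Arguments.
Unset Strict Implicit.
Unset Printing Implicit Defensive.

Import Order.TTheory GRing.Theory Num.Theory.
Import numFieldNormedType.Exports.

Local Open Scope classical_set_scope.
Local Open Scope ring_scope.

(* Up to a null set, the first point of [nu_i] exceeds [t] exactly when [nu_i]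
   has no point in ]0, t]; these void events are independent over [i], with
   probabilities exp(- rho_i ]0, t]).  Expanding the product of the
   [1 + c 1_{E_i}] over subsets gives the exponential moments of the number of
   void events; the resulting Chernoff bound decays geometrically in N, so by
   Borel-Cantelli the average of the void indicators minus its mean tends to 0
   almost surely.  The mean is the integral of exp(- s) against the empirical
   distribution, and exp(- s) is bounded and continuous on the half-line. *)

(** Multiply by [1 - x > 0]: the left side becomes at most exp(x) exp(- x) = 1, the right side 1 +
    x^2 (1 - 2x) >= 1. *)
Lemma expR_le_quadratic (R : realType) (x : R) : 0 <= x <= 2^-1 ->
  expR x <= 1 + x + 2 * x ^+ 2.
Proof.
move=> /andP[x0 x2].
have h : expR x * (1 - x) <= 1.
  by rewrite -[leRHS](expRxMexpNx_1 x) ler_wpM2l ?expR_ge0// expR_ge1Dx.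
have /(le_trans h) : 1 <= (1 + x + 2 * x ^+ 2) * (1 - x) by nra.
by rewrite ler_pM2r//; lra.
Qed.

(** * Exponential moments and a Chernoff bound for independent events *)

Section chernoff_bound.
Context d (T : measurableType d) (R : realType) (P : probability T R).
Context (I : finType) (E : I -> set T).
Hypothesis mE : forall i, measurable (E i).
Hypothesis indE : independent_systems P (fun i => [set E i]).

Lemma integral_prod_indic (c : R) : 0 <= c ->
  (\int[P]_w (\prod_i (1 + c * \1_(E i) w))%:E =
   (\prod_i (1 + c * fine (P (E i))))%:E)%E.
Proof.
move=> c0.
have expand (q : I -> R) : \prod_i (1 + c * q i) =
    \sum_(J : {set I}) c ^+ #|J| * \prod_(i in J) q i.
  (* With [c * q i] as first summand, [J] is the set of indices where that summand is picked. *)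
  under eq_bigr do rewrite addrC.
  rewrite bigA_distr; apply: eq_bigr => J _.
  rewrite (bigID (mem J))/= [X in _ * X]big1 ?mulr1; last first.
    by move=> i /negbTE ->.
  rewrite -prodr_const -big_split/=.
  by apply: eq_bigr => i ->.
have prod_indic (J : {set I}) w :
    \prod_(i in J) (\1_(E i) w : R) = \1_(\bigcap_(i in [set` J]) E i) w.
  rewrite [RHS]indicE; have [wE|] := boolP (w \in _).
    rewrite big1// => i iJ; rewrite indicE mem_set//.
    by move/set_mem : wE; exact.
  move/negP => wE; apply/eqP/prodf_eq0.
  apply: contrapT => nJ; apply: wE; apply/mem_set => i /= iJ.
  apply: contrapT => wi; apply: nJ; exists i => //.
  by rewrite indicE memNset.
have mcap (J : {set I}) : measurable (\bigcap_(i in [set` J]) E i).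
  by apply: fin_bigcap_measurable.
under eq_integral => w _.
  rewrite expand -sumEFin.
  under eq_bigr do rewrite prod_indic EFinM.
  over.
rewrite ge0_integral_sum//=; first last.
- by move=> J w _; rewrite -EFinM lee_fin mulr_ge0// exprn_ge0.
- move=> J; apply: measurable_funeM; apply/measurable_EFinP.
  exact: measurable_indic.
rewrite expand -sumEFin; apply: eq_bigr => J _.
rewrite ge0_integralZl//; first last.
- by rewrite lee_fin exprn_ge0.
- by apply/measurable_EFinP; exact: measurable_indic.
rewrite integral_indic// setIT EFinM -prodEFin; congr (_ * _)%E.
rewrite [LHS]indE//; apply: eq_bigr => i _.
by rewrite fineK// fin_num_measure.
Qed.

(** Markov's inequality for exp(l * count), whose mean is at most exp(c m) by 1 + x <= exp(x). *)
Lemma count_upper_tail (e : R) : 0 < e <= 1 ->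
  (P [set w | (\sum_i fine (P (E i)) + e * #|I|%:R <=
          (\sum_i \1_(E i) w : R))%R] <=
   (expR (- (e ^+ 2 / 8)) ^+ #|I|)%:E)%E.
Proof.
move=> /andP[e0 e1]; set m := \sum_i fine (P (E i)).
(* [l = e / 4] minimises the exponent [2 l^2 - l e], with value [- e^2 / 8]. *)
pose l := e / 4; pose c := expR l - 1.
have l0 : 0 < l by rewrite divr_gt0.
have c0 : 0 <= c by rewrite subr_ge0 -expR0 ler_expR ltW.
pose Z w := \prod_i (1 + c * \1_(E i) w : R).
(* As [c = expR l - 1], each factor of [Z] is exp(l) or 1. *)
have ZE w : Z w = expR (l * \sum_i (\1_(E i) w : R)).
  rewrite mulr_sumr expR_sum; apply: eq_bigr => i _; rewrite indicE.
  by case: (_ \in _); rewrite /= ?mulr1 ?mulr0 ?addr0 ?expR0 // /c addrC subrK.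
have mZ : measurable_fun setT Z.
  apply: measurable_prod => i _; apply: measurable_funD => //.
  exact: measurable_funM.
pose a := expR (l * (m + e * #|I|%:R)).
have mZ' : measurable_fun setT (EFin \o Z) by exact/measurable_EFinP.
have := le_integral_abse P measurableT mZ' (expR_gt0 _ : 0 < a).
rewrite setTI.
rewrite (_ : [set x | _] =
    [set w | m + e * #|I|%:R <= \sum_i (\1_(E i) w : R)]); last first.
  apply: eq_set => w /=.
  by rewrite lee_fin ZE ger0_norm ?expR_ge0// ler_expR ler_pM2l.
under eq_integral do rewrite /= ger0_norm ?ZE ?expR_ge0// -ZE.
rewrite integral_prod_indic// => /= h.
have {}h := le_trans h _.
have : (a%:E * P [set w | (m + e * #|I|%:R <= \sum_i (\1_(E i) w : R))%R] <=
    (expR (c * m))%:E)%E.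
  apply: h; rewrite lee_fin mulr_sumr expR_sum; apply: ler_prod => i _.
  by rewrite expR_ge1Dx andbT addr_ge0// mulr_ge0// fine_ge0.
rewrite muleC -lee_pdivlMr ?expR_gt0// => /le_trans; apply.
rewrite -EFinM lee_fin -expRN -expRD -expRM_natl ler_expR.
have m_le : m <= #|I|%:R.
  rewrite -sum1_card natr_sum; apply: ler_sum => i _.
  by rewrite -lee_fin fineK ?fin_num_measure// probability_le1.
have m0 : 0 <= m by apply: sumr_ge0 => i _; rewrite fine_ge0.
have el : expR l <= 1 + l + 2 * l ^+ 2.
  by apply: expR_le_quadratic; rewrite /l; lra.
(* The [l * m] of the threshold cancels the linear term of [c * m]; then [m <= #|I|] leaves
   [2 l^2 - l e] per event. *)
apply: (@le_trans _ _ (2 * l ^+ 2 * m - l * (e * #|I|%:R))).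
  suff : (expR l - 1 - l) * m <= 2 * l ^+ 2 * m by rewrite /c; lra.
  by apply: ler_wpM2r => //; lra.
have := ler_wpM2l (_ : 0 <= 2 * l ^+ 2) m_le.
rewrite mulr_ge0 ?sqr_ge0// => /(_ isT); rewrite /l; lra.
Qed.

End chernoff_bound.

(** * Strong law for row-wise independent events *)

Section triangular_array.
Context d (T : measurableType d) (R : realType) (P : probability T R).

(** The exceedance probabilities are dominated by a geometric series, so the first Borel-Cantelli
    lemma applies, whatever the dependence between rows. *)
Lemma ae_count_upper_bound (E : forall N, 'I_N -> set T) (e : R) :
  (forall N i, measurable (E N i)) ->
  (forall N, independent_systems P (fun i => [set E N i])) ->
  0 < e <= 1 ->
  {ae P, forall w, \forall N \near \oo,
    \sum_i (\1_(E N i) w : R) < \sum_i fine (P (E N i)) + e * N%:R}.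
Proof.
move=> mE indE e01; have e0 : 0 < e by case/andP: e01.
pose F N := [set w | \sum_i fine (P (E N i)) + e * N%:R <=
                     \sum_i (\1_(E N i) w : R)].
have mF N : measurable (F N).
  rewrite -[F N]setTI; apply: measurable_fun_le => //.
  refine (measurable_sum _ (h := fun i => \1_(E N i)) _) => i.
  exact: measurable_indic.
pose r := expR (- (e ^+ 2 / 8)).
have r1 : r < 1 by rewrite /r -expR0 ltr_expR oppr_lt0 divr_gt0// exprn_gt0.
have PF N : (P (F N) <= (r ^+ N)%:E)%E.
  by have := count_upper_tail (mE N) (indE N) e01; rewrite card_ord.
have PF_oo : (\sum_(N <oo) P (F N) < +oo)%E.
  apply: (@le_lt_trans _ _ (1 / (1 - r))%:E); last exact: ltry.
  apply: lime_le; first exact: is_cvg_nneseries.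
  apply: nearW => n; apply: (@le_trans _ _ (\sum_(0 <= i < n) (r ^+ i)%:E)%E).
    by apply: lee_sum => i _.
  rewrite sumEFin lee_fin.
  have nr1 : `|r| < 1 by rewrite ger0_norm ?expR_ge0.
  have := geometric_le_lim n (@ler01 R) (expR_gt0 _ : 0 < r) nr1.
  by rewrite /series/= (eq_bigr _ (fun i _ => mul1r (r ^+ i))).
exists (lim_sup_set F); split.
- by apply: bigcap_measurable => // n _; exact: bigcup_measurable.
- exact: lim_sup_set_cvg0.
- move=> w /= nw n _; apply: contrapT => nF; apply: nw.
  exists n => // m /= nm; rewrite ltNge; apply/negP => Fm.
  by apply: nF; exists m.
Qed.

Lemma independent_systems_sub (I : finType) (F G : I -> set_system T) :
  (forall i, F i `<=` G i) ->
  independent_systems P G -> independent_systems P F.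
Proof. by move=> FG indG J E EF; apply: indG => i iJ; exact/FG/EF. Qed.

(** The lower deviation is the upper deviation of the complements, hence both events in the
    independence hypothesis. *)
Lemma strong_law_triangular_array (E : forall N, 'I_N -> set T) :
  (forall N i, measurable (E N i)) ->
  (forall N, independent_systems P (fun i => [set E N i; ~` E N i])) ->
  {ae P, forall w,
    N%:R^-1 * \sum_i (\1_(E N i) w - fine (P (E N i)))
      @[N --> \oo] --> (0 : R)}.
Proof.
move=> mE indE.
have indE1 N : independent_systems P (fun i => [set E N i]).
  by apply: independent_systems_sub (indE N) => i A ->; left.
have indE2 N : independent_systems P (fun i => [set ~` E N i]).
  by apply: independent_systems_sub (indE N) => i A ->; right.
have mEC N i : measurable (~` E N i) by exact: measurableC.
(* Countably many thresholds 1/(k+1), so that one null set serves them all. *)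
have k01 k : 0 < (k.+1%:R^-1 : R) <= 1.
  by rewrite invr_gt0 ltr0n invf_le1 ?ltr0n// ler1n.
have upper := ae_foralln (fun k => ae_count_upper_bound mE indE1 (k01 k)).
have lower := ae_foralln (fun k => ae_count_upper_bound mEC indE2 (k01 k)).
apply: filterS2 upper lower => w upper lower.
have sumC N : \sum_i ((\1_(~` E N i) w : R) - fine (P (~` E N i))) =
    - \sum_i (\1_(E N i) w - fine (P (E N i))).
  rewrite -sumrN; apply: eq_bigr => i _.
  rewrite probability_setC// fineB ?fin_num_measure//= !indicE in_setC.
  by case: (_ \in _) => /=; lra.
apply/cvgr0Pnorm_le => e e0.
have [k ke] : exists k, k.+1%:R^-1 < e.
  by have [k _ /(_ k (leqnn k))] := near_infty_natSinv_lt (PosNum e0); exists k.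
near=> N.
have N0 : 0 < N%:R :> R by rewrite ltr0n; near: N; exact: nbhs_infty_gt.
rewrite normrM gtr0_norm ?invr_gt0// mulrC ler_pdivrMr//.
apply: (@le_trans _ _ (k.+1%:R^-1 * N%:R)); last by rewrite ler_pM2r// ltW.
have up : \sum_i (\1_(E N i) w : R) <
    \sum_i fine (P (E N i)) + k.+1%:R^-1 * N%:R.
  by near: N; exact: upper.
have lo : \sum_i (\1_(~` E N i) w : R) <
    \sum_i fine (P (~` E N i)) + k.+1%:R^-1 * N%:R.
  by near: N; exact: lower.
rewrite ler_norml; apply/andP; split.
  by rewrite -lerN2 -sumC opprK sumrB lerBlDl ltW.
by rewrite sumrB lerBlDl ltW.
Unshelve. all: by end_near. Qed.

End triangular_array.

Lemma Rintegral_empirical (R : realType) (N : nat)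
    (x : 'I_N -> measurableTypeR R) (D : set (measurableTypeR R)) (f : R -> R) :
  measurable D -> measurable_fun D f -> (forall y, D y -> 0 <= f y) ->
  (forall i, D (x i)) ->
  \int[empirical x]_(y in D) f y = N%:R^-1 * \sum_(i < N) f (x i).
Proof.
move=> mD mf f0 Dx.
have n0 : 0 <= N%:R^-1 :> R by rewrite invr_ge0.
(* [msum] takes a sequence indexed by [nat]; the default point 0 only occurs for k >= N, outside the
   sum. *)
pose m_ k : {measure set (measurableTypeR R) -> \bar R} :=
  \d_(oapp x 0 (insub k)).
rewrite /Rintegral (_ : (\int[_]_(y in D) _)%E =
    (\int[mscale (NngNum n0) (msum m_ N)]_(y in D) (f y)%:E)%E); last first.
  apply: eq_measure_integral => A mA AD.
  rewrite /mscale /= /empirical /msum; congr (_ * _)%E.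
  by apply: eq_bigr => i _; rewrite /m_ valK.
have mfE : measurable_fun D (EFin \o f) by exact/measurable_EFinP.
have f0E y : D y -> (0 <= (f y)%:E)%E by move=> Dy; rewrite lee_fin f0.
rewrite ge0_integral_mscale// ge0_integral_measure_sum//.
rewrite (eq_bigr (fun i : 'I_N => (f (x i))%:E)); last first.
  by move=> i _; rewrite integral_dirac// diracE /= valK/= mem_set// mul1e.
by rewrite sumEFin -EFinM.
Qed.

(** * Void events of Poisson random measures *)

Section poisson_void.
Context d (T : measurableType d) (R : realType) (P : probability T R).
Implicit Types (nu : R.-ker T ~> measurableTypeR R)
  (rho : {measure set (measurableTypeR R) -> \bar R}).

Lemma radon_itv_fin_num rho (a b : R) :
  radon rho -> rho `]a, b]%classic \is a fin_num.
Proof.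
move=> [rho_fin _]; rewrite ge0_fin_numE//.
apply: le_lt_trans (rho_fin _ (@segment_compact R a b)).
by apply: le_measure; rewrite ?inE//; apply: subset_itvr; rewrite bnd_simp.
Qed.

Lemma poisson_void_probability nu rho (A : set (measurableTypeR R)) :
  poisson_random_measure P nu rho -> measurable A -> rho A \is a fin_num ->
  P [set w | nu w A = 0%E] = (expR (- fine (rho A)))%:E.
Proof.
move=> [Pnu _ _] mA fA.
have := Pnu A (fine (rho A)) mA (esym (fineK fA)) 0%N.
(* [poisson_prob] branches on the sign of the rate; at rate 0 it is the unit mass at 0, in agreement
   with exp(0) = 1. *)
move=> /= ->; rewrite /poisson_prob; case: ifPn => [r0|].
  rewrite esum_set1 ?lee_fin ?poisson_pmf_ge0// /poisson_pmf r0.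
  by rewrite expr0 fact0 invr1 !mul1r.
rewrite -leNgt => r0; rewrite diracE mem_set//.
suff -> : fine (rho A) = 0 by rewrite oppr0 expR0.
by apply/eqP; rewrite eq_le r0 fine_ge0.
Qed.

Lemma random_measure_sigma_void nu (A : set (measurableTypeR R)) :
  measurable A -> random_measure_sigma nu [set w | nu w A = 0%E].
Proof.
move=> mA; apply: sub_sigma_algebra; exists A => //.
by exists [set 0%E]; [exact: emeasurable_set1|rewrite setTI].
Qed.

End poisson_void.

(** If the first point exceeds [t], so do all later ones; otherwise the term j = 0 already
    contributes 1 to the sum. *)
Lemma no_point_before_first (R : realType) (x : nat -> R) (t : R) :
  0 < x 0%N -> (forall j, x j < x j.+1) ->
  (\sum_(0 <= j <oo) \d_(x j : measurableTypeR R) `]0%R, t]%classic)%E =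
    0%E :> \bar R <-> t < x 0%N.
Proof.
move=> x0 /(homo_ltn lt_trans) x_incr; split=> [|tx]; last first.
  apply: eseries0 => j _ _; rewrite diracE memNset//= in_itv/= => /andP[_].
  apply/negP; rewrite -ltNge (lt_le_trans tx)//.
  by case: j => // j; apply/ltW/x_incr.
apply: contraPlt => xt; apply/eqP; rewrite gt_eqF//.
have := @nneseries_lim_ge R
  (fun j => \d_(x j : measurableTypeR R) `]0%R, t]%classic) xpredT 0%N 1%N.
rewrite big_nat1 diracE mem_set/= ?in_itv/= ?x0//.
move=> /(_ (fun _ _ _ => measure_ge0 _ _)).
by apply: lt_le_trans; rewrite lte01.
Qed.

Theorem proposition1p1 (R : realType) (d : measure_display)
  (Omega : measurableType d) (P : probability Omega R)
  (rho : forall N : nat,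
     'I_N -> {measure set (measurableTypeR R) -> \bar R})
  (nu : forall N : nat, 'I_N -> R.-ker Omega ~> measurableTypeR R)
  (tau : forall N : nat, 'I_N -> nat -> Omega -> R)
  (rho_half_line : forall (N : nat) (i : 'I_N), on_half_line (rho N i))
  (rho_radon : forall (N : nat) (i : 'I_N), radon (rho N i))
  (rho_continuous : forall (N : nat) (i : 'I_N), continuous_measure (rho N i))
  (nu_poisson : forall (N : nat) (i : 'I_N),
     poisson_random_measure P (nu N i) (rho N i))
  (nu_independent : forall N : nat, independent_random_measures P (nu N))
  (nu_points : forall N : nat,
     simple_point_representation P (nu N) (tau N))
  (t : R) (t_ge0 : 0 <= t)
  (lambda_t : probability (measurableTypeR R) R)
  (lambda_half_line : on_half_line lambda_t)
  (lambda_cvg : weak_cvg_half_line (lambdaN rho t) lambda_t) :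
  {ae P, forall w, Y_C tau t N w @[N --> \oo] --> y_C lambda_t}.
Proof.
pose A : set (measurableTypeR R) := `]0, t]%classic.
pose r N i := fine (rho N i A).
pose E N i := [set w | nu N i w A = 0%E].
have mA : measurable A by exact: measurable_itv.
have PE N i : P (E N i) = (expR (- r N i))%:E.
  by apply: poisson_void_probability => //; exact: radon_itv_fin_num.
have mE N i : measurable (E N i).
  rewrite -[E N i]setTI.
  apply: (measurable_kernel (nu N i) A mA measurableT [set 0%E]).
  exact: emeasurable_set1.
have indE N : independent_systems P (fun i => [set E N i; ~` E N i]).
  apply: independent_systems_sub (nu_independent N) => i B [->|->].
    exact: random_measure_sigma_void.
  (* Independence is assumed for whole sigma-algebras, so it covers the complements of void events
     too. *)
  rewrite -setTD; apply: sigma_algebraCD; exact: random_measure_sigma_void.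
have void_cvg : N%:R^-1 * \sum_i expR (- r N i) @[N --> \oo] -->
    \int[lambda_t]_(s in `[0%R, +oo[%classic) expR (- s).
  have cexp : continuous (fun s : R => expR (- s)).
    move=> s; apply: continuous_comp; first exact: opp_continuous.
    exact: continuous_expR.
  have := lambda_cvg (fun s => expR (- s)) (continuous_subspaceT cexp).
  rewrite (_ : (fun N => _) = (fun N => N%:R^-1 * \sum_i expR (- r N i))).
    apply; exists 1 => s s0.
    by rewrite ger0_norm ?expR_ge0// -expR0 ler_expR oppr_le0.
  apply/funext => N; rewrite /lambdaN Rintegral_empirical//.
  - apply: measurable_funTS; exact: continuous_measurable_fun.
  - by move=> i; rewrite /= in_itv/= andbT fine_ge0.
have points := ae_foralln nu_points.
apply: filterS2 points (strong_law_triangular_array mE indE) => w points slln.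
(* Each indicator of tau <= t is 1 - 1_E; adding and subtracting P(E) = exp(- r) separates
   fluctuation from mean. For N = 0 the average of the constant 1 would be 0. *)
have Y_CE N : (0 < N)%N -> Y_C tau t N w =
    1 - N%:R^-1 * \sum_i (\1_(E N i) w - fine (P (E N i)))
      - N%:R^-1 * \sum_i expR (- r N i).
  move=> N0; have [nu_tau tau_gt0 tau_incr _] := points N.
  have {1}-> : 1 = N%:R^-1 * \sum_(i < N) 1 :> R.
    by rewrite sumr_const card_ord mulVf// pnatr_eq0 -lt0n.
  rewrite -!mulrBr -!sumrB /Y_C.
  congr (_ * _); apply: eq_bigr => i _; rewrite PE /=.
  have -> : \1_(E N i) w = (t < tau N i 0%N w)%R%:R :> R.
    have := no_point_before_first t (tau_gt0 i) (tau_incr i).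
    rewrite -nu_tau// indicE => E_tau; congr (nat_of_bool _)%:R.
    by apply/idP/idP => [/set_mem/E_tau//|lt_t]; exact/mem_set/E_tau.
  by rewrite leNgt; case: (_ < _); rewrite /=; lra.
apply: (@cvg_trans _ ((fun N =>
    1 - N%:R^-1 * \sum_i (\1_(E N i) w - fine (P (E N i)))
      - N%:R^-1 * \sum_i expR (- r N i)) @ \oo)).
  apply: near_eq_cvg; near=> N; rewrite Y_CE//.
  by near: N; exact: nbhs_infty_gt.
rewrite /y_C -[X in X - _]subr0; apply: cvgB void_cvg.
by apply: cvgB slln; exact: cvg_cst.
Unshelve. all: by end_near. Qed.
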